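(* Let $\overline{\mathcal{L}}$ be the set of overpartitions in which the last occurrence of a number may be overlined and no two adjacent parts are both overlined. Then $\overline{\mathcal{L}}$ is a separable overpartition class.
   Context: An overpartition (in the ''last occurrence'' convention) is a partition in which the last occurrence of a number may be overlined; parts are listed in non-increasing order of size, with $\overline{t}$ listed after the non-overlined copies of $t$. Adjacency refers to positions in this list. For a positive integer $t$ and nonnegative integer $d$, $\overline{t}+d=\overline{t+d}$. A separable overpartition class is a set $\mathcal{P}$ of overpartitions for which there is a subset $\mathcal{B}\subset\mathcal{P}$ (the basis) such that for each $m\geq 1$ the number of overpartitions in $\mathcal{B}$ with $m$ parts is finite, every overpartition in $\mathcal{P}$ with $m$ parts is uniquely of the form $(b_1+\pi_1,\ldots,b_m+\pi_m)$ with $(b_1,\ldots,b_m)\in\mathcal{B}$ and $(\pi_1,\ldots,\pi_m)$ a non-increasing sequence of nonnegative integers, and all overpartitions of this form lie in $\mathcal{P}$. *)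

(* Defs.v *)
From mathcomp Require Import all_boot.
From mathcomp Require Import boolp classical_sets cardinality.

Set Implicit Arguments.
Unset Strict Implicit.
Unset Printing Implicit Defensive.

Local Open Scope classical_set_scope.

(* (t, true) is the overlined part t, (t, false) the non-overlined part t. *)
Definition part : Type := (nat * bool)%type.

Definition part_size (p : part) : nat := p.1.
Definition overlined (p : part) : bool := p.2.

(* The list of parts, in order. The last conjunct says that an overlined part
   is the last occurrence of its size; hence each size is overlined at most
   once, and the overlined copy comes after the non-overlined ones. *)
Definition overpartition (l : seq part) : bool :=
  [&& all (fun p => 0 < part_size p) l,
      sorted geq (map part_size l) &
      pairwise (fun p q => overlined p ==> (part_size p != part_size q)) l].

Definition part_add (p : part) (d : nat) : part :=
  (part_size p + d, overlined p).

(* Only meaningful when b and pi have the same length (zip truncates). *)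
Definition overpart_add (b : seq part) (pi : seq nat) : seq part :=
  [seq part_add x.1 x.2 | x <- zip b pi].

Definition separable_overpartition_class (P : set (seq part)) : Prop :=
  P `<=` [set l | overpartition l] /\
  exists B : set (seq part), B `<=` P /\
    forall m : nat, 1 <= m ->
      [/\ finite_set [set b | B b /\ size b = m],
          forall l, P l -> size l = m ->
            exists! bpi : seq part * seq nat,
              [/\ B bpi.1, size bpi.1 = m, size bpi.2 = m,
                  sorted geq bpi.2 & l = overpart_add bpi.1 bpi.2] &
          forall (b : seq part) (pi : seq nat),
            B b -> size b = m -> size pi = m -> sorted geq pi ->
            P (overpart_add b pi)].

(* [sorted] with a non-transitive relation constrains consecutive entries only. *)
Definition Lbar : set (seq part) :=
  [set l | overpartition l /\
           sorted (fun p q => ~~ (overlined p && overlined q)) l].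

(* Main.v *)
From mathcomp Require Import all_boot.
From mathcomp Require Import boolp classical_sets cardinality.
From mathcomp Require Import zify.
Require Import Defs.

Set Implicit Arguments.
Unset Strict Implicit.
Unset Printing Implicit Defensive.

Local Open Scope classical_set_scope.

(** A list of parts is an overpartition when its last part is positive and each
    other part exceeds the next one by at least 1 if it is overlined and by at
    least 0 otherwise. Hence among the overpartitions with a given pattern of
    overlines there is a least one, in which all these bounds are equalities,
    and the others are obtained from it by adding a non-increasing sequence.
    So any class of overpartitions defined by a condition on the pattern of
    overlines is separable. *)

Fixpoint least_overpartition (s : seq bool) : seq part :=
  if s is o :: s' then
    let t := least_overpartition s' in
    ((if t is q :: _ then part_size q + o else 1), o) :: t
  else [::].

(** Sizes do not increase along the list, so a part that exceeds its successor differs in size from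
    all later parts. This makes the pairwise condition on overlines local. *)
Lemma overpartition_cons (p : part) (l : seq part) :
  overpartition (p :: l) =
  overpartition l &&
  (if l is q :: _ then part_size q + overlined p <= part_size p
   else 0 < part_size p).
Proof.
rewrite /overpartition; case: l => [|q l] /=; first by rewrite !andbT.
set A := all _ l; set S := path _ _ _; set W := pairwise _ l.
case: (boolP A) => [_|_]; last by rewrite !andbF.
case: (boolP S) => [path_l|_]; last by rewrite !(andbF, andFb).
set U := all (fun r => overlined q ==> _) l.
case: (boolP W) => [_|_]; last by rewrite !andbF.
case: (boolP U) => [_|_]; last by rewrite !andbF.
rewrite /= !andbT.
have le_q : all (fun r : part => part_size r <= part_size q) l.
  have := order_path_min (rev_trans leq_trans) path_l.
  by rewrite all_map; apply: sub_all => r.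
(* Without an overline on [p] the pairwise condition is vacuous; with one, only a strict descent to
   [q] is compatible with it. *)
case: (overlined p) => /=; last by rewrite all_predT; lia.
have [lt_qp|] := ltnP (part_size q) (part_size p); last by lia.
have -> : all (fun r => part_size p != part_size r) l.
  by apply: sub_all le_q => r; lia.
by lia.
Qed.

Lemma least_overpartitionP (s : seq bool) :
  overpartition (least_overpartition s).
Proof.
elim: s => //= o s IHs; rewrite overpartition_cons IHs /=.
by case: (least_overpartition s).
Qed.

Lemma overlined_least_overpartition (s : seq bool) :
  map overlined (least_overpartition s) = s.
Proof. by elim: s => //= o s ->. Qed.

Lemma size_least_overpartition (s : seq bool) :
  size (least_overpartition s) = size s.
Proof. by rewrite -[in RHS](overlined_least_overpartition s) size_map. Qed.

Lemma overlined_overpart_add (b : seq part) (pi : seq nat) :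
  size pi = size b -> map overlined (overpart_add b pi) = map overlined b.
Proof.
by elim: b pi => [|p b IHb] [|d pi] //= [eq_sz]; rewrite IHb.
Qed.

Lemma overpart_addI (b : seq part) (pi pi' : seq nat) :
  size pi = size b -> size pi' = size b ->
  overpart_add b pi = overpart_add b pi' -> pi = pi'.
Proof.
elim: b pi pi' => [|p b IHb] [|d pi] [|d' pi'] //= [sz] [sz'].
by case=> /addnI -> /IHb ->.
Qed.

(** Adding a non-increasing [pi] can only widen the gaps between adjacent parts, so the bounds of
    [overpartition_cons] persist. *)
Lemma overpartition_add (b : seq part) (pi : seq nat) :
  overpartition b -> size pi = size b -> sorted geq pi ->
  overpartition (overpart_add b pi).
Proof.
elim: b pi => [|p b IHb] [|d pi] //; rewrite overpartition_cons.
case/andP=> over_b le_b [sz] pi_sorted.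
rewrite [overpart_add _ _]/= overpartition_cons IHb ?(path_sorted pi_sorted) //=.
case: b pi sz le_b pi_sorted {IHb over_b} => [|q b] [|e pi] //= _.
  by rewrite /part_size /=; lia.
by move=> + /andP[]; rewrite /part_size /overlined /=; lia.
Qed.

(** The gaps of [l] are at least those of the least overpartition with its overlines, so the
    partwise differences do not increase. *)
Lemma overpartition_decomp (l : seq part) :
  overpartition l ->
  exists pi : seq nat,
    [/\ size pi = size l, sorted geq pi &
        l = overpart_add (least_overpartition (map overlined l)) pi].
Proof.
elim: l => [|p l IHl]; first by exists [::].
rewrite overpartition_cons => /andP[/IHl[pi [sz pi_sorted def_l]] le_l].
have -> : map overlined (p :: l) = overlined p :: map overlined l by [].
(* From here on only the length of [s] and the decomposition of [l] matter; [s] is made arbitrary so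
   that it can be destructed alongside [l]. *)
move: sz le_l def_l; set s := map overlined l.
have : size s = size l by rewrite size_map.
move: s => s; case: l {IHl} => [|q l].
  case: s pi pi_sorted => [|//] [|//] _ _ _ p_gt0 _; exists [:: (part_size p).-1].
  split=> //=; congr [:: _]; case: p p_gt0 => [n o].
  by rewrite /part_add /part_size /overlined /= => n_gt0; congr pair; lia.
case: s pi pi_sorted => [|o s] [|d pi] //= pi_sorted sz_s sz_pi le_qp [].
set k := (X in part_add (X, o)) => def_q def_l.
have le_kp : k + d + overlined p <= part_size p by move: le_qp; rewrite def_q.
(* The least overpartition for the whole pattern begins with size [k + overlined p]; by [le_kp] the
   new entry is at least [d]. *)
exists [:: part_size p - (k + overlined p), d & pi]; split=> //=.
- by rewrite sz_pi.
- by rewrite pi_sorted andbT; lia.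
- rewrite def_q {1}def_l /overpart_add /= -/k; congr cons.
  move: k le_kp {def_q} => k; case: p {le_qp} => [n o'].
  by rewrite /part_add /part_size /overlined /= => le_n; congr pair; lia.
Qed.

Lemma separable_overlined_pattern (Q : set (seq bool)) :
  separable_overpartition_class
    [set l | overpartition l /\ Q (map overlined l)].
Proof.
split; first by move=> l [].
exists (least_overpartition @` Q); split.
  move=> _ [s Qs <-]; split; first exact: least_overpartitionP.
  by rewrite overlined_least_overpartition.
move=> m _; split.
(* There are finitely many overline patterns of length [m], and each gives one basis element. *)
- apply: (@sub_finite_set _ _
    ((fun s : m.-tuple bool => least_overpartition s) @` setT)).
    move=> _ [[s _ <-]]; rewrite size_least_overpartition => sz_s.
    by exists (tcast sz_s (in_tuple s)); rewrite ?val_tcast.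
  exact/finite_image/finite_finset.
- move=> l [/overpartition_decomp[pi [sz_pi pi_sorted def_l]] Ql] sz_l.
  exists (least_overpartition (map overlined l), pi); split.
    split=> //=; first by exists (map overlined l).
    + by rewrite size_least_overpartition size_map.
    + by rewrite sz_pi.
  move=> [b pi'] [/= [s _ <-] sz_b sz_pi' _ def_l'].
  (* Addition keeps the overlines, so [l] determines the pattern and with it the basis element;
     cancellation then determines [pi']. *)
  have eq_s : map overlined l = s.
    by rewrite def_l' overlined_overpart_add ?sz_b //
               overlined_least_overpartition.
  rewrite eq_s in def_l *; congr pair.
  apply: (@overpart_addI (least_overpartition s)); rewrite ?sz_b ?sz_pi //.
  by rewrite -def_l.
- move=> _ pi [s Qs <-] sz_s sz_pi pi_sorted; split.
    by apply: overpartition_add; rewrite ?sz_s //; exact: least_overpartitionP.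
  by rewrite overlined_overpart_add ?sz_s // overlined_least_overpartition.
Qed.

Theorem theorem5p3 : separable_overpartition_class Lbar.
Proof.
have -> : Lbar = [set l | overpartition l /\
    sorted (fun o o' => ~~ (o && o')) (map overlined l)].
  by apply/seteqP; split=> l /=; rewrite sorted_map.
exact: (@separable_overlined_pattern
  (fun s => sorted (fun o o' => ~~ (o && o')) s)).
Qed.
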